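(* Let $\Lambda$ be a good ordered commutative monoid, and let $K_*=(K_\lambda)_{\lambda\in\Lambda}$ be a $\Lambda$-filtered group. Then the bracket maps $$[\ ,\ ]\colon \bar K_\lambda\times\bar K_\mu\to\bar K_{\lambda+\mu},\qquad [[a]_\lambda,[b]_\mu]=[[a,b]]_{\lambda+\mu}\quad (a\in K_\lambda,\ b\in K_\mu),$$ for $\lambda,\mu>0$, form a $\Lambda_+$-graded Lie algebra structure on the graded abelian group $\bar K=\bigoplus_{\lambda>0}\bar K_\lambda$.
   Context: An ordered commutative monoid is a commutative monoid $(\Lambda,+,0)$ with a partial order $\le$ such that $\lambda\le\lambda'$ implies $\lambda+\mu\le\lambda'+\mu$. It is good if $0\le\lambda$ for all $\lambda\in\Lambda$ and if $\lambda<\lambda'$ implies $\lambda+\mu<\lambda'+\mu$. Put $\Lambda_+=\Lambda\setminus\{0\}=\{\lambda\in\Lambda\mid\lambda>0\}$. A $\Lambda$-filtration of a group $K$ is a family $K_*=(K_\lambda)_{\lambda\in\Lambda}$ of normal subgroups of $K$ such that $K_0=K$, $K_\lambda\supset K_\mu$ whenever $\lambda\le\mu$, and $[K_\lambda,K_\mu]\subset K_{\lambda+\mu}$ for all $\lambda,\mu\in\Lambda$. A $\Lambda$-filtered group is a group with a $\Lambda$-filtration. Here $[a,b]=aba^{-1}b^{-1}$. $K_{>\lambda}$ denotes the subgroup generated by $\bigcup_{\mu>\lambda}K_\mu$ (it is normal in $K$ and contained in $K_\lambda$). Set $\bar K_\lambda=K_\lambda/K_{>\lambda}$, and write $[a]_\lambda=aK_{>\lambda}$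 for $a\in K_\lambda$. For $\lambda>0$ the group $\bar K_\lambda$ is abelian, and the bracket maps in the claim are well defined. A $\Lambda_+$-graded Lie algebra is a Lie algebra $L$ over $\mathbb Z$ with a direct sum decomposition $L=\bigoplus_{\lambda\in\Lambda_+}L_\lambda$ such that $[L_\lambda,L_\mu]\subset L_{\lambda+\mu}$. *)

(* Defs.v *)
From HB Require Import structures.
From mathcomp Require Import all_boot all_order all_algebra.
From mathcomp Require Import boolp classical_sets functions cardinality fsbigop.

Set Implicit Arguments.
Unset Strict Implicit.
Unset Printing Implicit Defensive.

Import Order.TTheory GRing.Theory.
Local Open Scope classical_set_scope.
Local Open Scope quotient_scope.
Local Open Scope ring_scope.

Record orderedMonoidType (d : Order.disp_t) := OrderedMonoid {
  om_sort :> porderType d;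
  om_zero : om_sort;
  om_add : Monoid.com_law om_zero;
  om_leD2r : forall x y z : om_sort,
    (x <= y)%O -> (om_add x z <= om_add y z)%O
}.

Declare Scope om_scope.
Delimit Scope om_scope with om.
Notation "0" := (om_zero _) : om_scope.
Notation "x + y" := (om_add _ x y) : om_scope.

Record goodMonoidType (d : Order.disp_t) := GoodMonoid {
  good_om :> orderedMonoidType d;
  good_le0 : forall x : good_om, (0%om <= x)%O;
  good_ltD2r : forall x y z : good_om, (x < y)%O -> ((x + z)%om < (y + z)%om)%O
}.

Definition positive d (L : orderedMonoidType d) : Type :=
  {x : L | (0%om < x)%O}.

HB.instance Definition _ d (L : orderedMonoidType d) :=
  SubChoice.on (positive L).

Section PositiveAddition.
Context {d : Order.disp_t} {L : goodMonoidType d}.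

Lemma padd_subproof (x y : positive L) : (0%om < (sval x + sval y)%om)%O.
Proof.
case: x y => [x x0] [y y0] /=; apply: (lt_trans y0).
by rewrite -[X in (X < _)%O](Monoid.mul1m (om_add L)); apply: good_ltD2r.
Qed.

Definition padd (x y : positive L) : positive L :=
  exist _ (sval x + sval y)%om (padd_subproof x y).

End PositiveAddition.

Section Subgroups.
Context {K : groupType}.
Implicit Types (A B : set K) (x y : K).

Record is_subgroup A : Prop := {
  subgroup1 : A 1%g;
  subgroupM : forall x y, A x -> A y -> A (x * y)%g;
  subgroupV : forall x, A x -> A (x^-1)%g
}.

Definition is_normal A : Prop :=
  is_subgroup A /\ forall x y, A x -> A (y * x * y^-1)%g.

Definition generated A : set K := smallest is_subgroup A.

(* This is not MathComp's [~ x, y], which is x^-1 y^-1 x y. *)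
Definition comm x y : K := (x * y * x^-1 * y^-1)%g.

Definition comm_subgroup A B : set K :=
  generated [set z | exists x y, [/\ A x, B y & z = comm x y]].

Lemma ldiv_commute x y : ((x * y)^-1 * (y * x) = comm y^-1 x^-1)%g.
Proof. by rewrite /comm !invgK invgM mulgA. Qed.

Lemma generated_subgroup A : is_subgroup (generated A).
Proof.
split.
- by move=> B [[]].
- move=> x y Ax Ay B BP; have [[_ BM _] _] := BP.
  by apply: BM; [exact: Ax|exact: Ay].
- move=> x Ax B BP; have [[_ _ BV] _] := BP.
  by apply: BV; exact: Ax.
Qed.

Lemma sub_generated A : A `<=` generated A.
Proof. exact: sub_gen_smallest. Qed.

Lemma generated_normal A :
  (forall x y, A x -> A (y * x * y^-1)%g) -> is_normal (generated A).
Proof.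
move=> AJ; split; first exact: generated_subgroup.
move=> x y; have [g1 gM gV] := generated_subgroup A.
pose B : set K := [set x | generated A (y * x * y^-1)%g].
suff: generated A `<=` B by apply.
apply: smallest_sub => [|z Az]; last by apply: sub_generated; apply: AJ.
split; rewrite /B /=.
- by rewrite mulg1 mulgV.
- move=> u v Hu Hv; have := gM _ _ Hu Hv.
  by rewrite !mulgA mulgVK.
- by move=> u /gV; rewrite !invgM invgK mulgA.
Qed.

(* x A = y A *)
Definition same_lcoset A x y : Prop := A (x^-1 * y)%g.

Lemma same_lcosetxx A x : is_subgroup A -> same_lcoset A x x.
Proof. by case=> A1 _ _; rewrite /same_lcoset mulVg. Qed.

Lemma same_lcoset_sym A x y :
  is_subgroup A -> same_lcoset A x y -> same_lcoset A y x.
Proof. by case=> _ _ AV /AV; rewrite /same_lcoset invgM invgK. Qed.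

Lemma same_lcoset_trans A y x z : is_subgroup A ->
  same_lcoset A x y -> same_lcoset A y z -> same_lcoset A x z.
Proof.
case=> _ AM _ xy yz; have := AM _ _ xy yz.
by rewrite /same_lcoset mulgA mulgK.
Qed.

Lemma same_lcosetM A x x' y y' : is_normal A ->
  same_lcoset A x x' -> same_lcoset A y y' -> same_lcoset A (x * y)%g (x' * y')%g.
Proof.
move=> [[_ AM _] AJ] xx yy; have := AM _ _ (AJ _ y^-1%g xx) yy.
by rewrite /same_lcoset invgM invgK !mulgA mulgK.
Qed.

End Subgroups.

Record filtration d (L : orderedMonoidType d) (K : groupType) := Filtration {
  filt :> L -> set K;
  filt_normal : forall l, is_normal (filt l);
  filt0 : filt 0%om = setT;
  filt_anti : forall l m, (l <= m)%O -> filt m `<=` filt l;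
  filt_comm_subgroup : forall l m,
    comm_subgroup (filt l) (filt m) `<=` filt (l + m)%om
}.

Section GradedPieces.
Context {d : Order.disp_t} {L : orderedMonoidType d} {K : groupType}.
Variable F : filtration L K.

Definition filt_gt (l : L) : set K :=
  generated (\bigcup_(m in [set m | (l < m)%O]) F m).

Lemma filt_gt_normal l : is_normal (filt_gt l).
Proof.
apply: generated_normal => x y [m lm Fx]; exists m => //.
by apply: (filt_normal F m).2.
Qed.

(* K_l as a type *)
Definition piece (l : L) : Type := {x : K | x \in F l}.

HB.instance Definition _ l := SubChoice.on (piece l).

Lemma piece_group_closed l : group_closed (fun x : K => x \in F l).
Proof.
have [[F1 FM FV] _] := filt_normal F l.
split; first by rewrite unfold_in inE.
move=> x y; rewrite !unfold_in !inE => Fx Fy.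
by apply: FM => //; apply: FV.
Qed.

HB.instance Definition _ l :=
  SubChoice_isSubGroup.Build K (fun x : K => x \in F l) (piece l)
    (@piece_group_closed l).

Definition coset_rel (l : L) (a b : piece l) : bool :=
  `[< same_lcoset (filt_gt l) (val a) (val b) >].

Lemma coset_rel_equiv l : equiv_class_of (@coset_rel l).
Proof.
have [gS _] := filt_gt_normal l; split.
- by move=> a; apply/asboolP; apply: same_lcosetxx.
- by move=> a b; apply/asboolP/asboolP; apply: same_lcoset_sym.
- move=> b a c /asboolP ab /asboolP bc; apply/asboolP.
  exact: same_lcoset_trans bc.
Qed.

Canonical coset_equiv_rel l := EquivRelPack (coset_rel_equiv l).

(* \bar K_l = K_l / K_{>l} *)
Definition gr (l : L) : Type := {eq_quot (coset_equiv_rel l)}.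

HB.instance Definition _ l := Choice.on (gr l).
HB.instance Definition _ l := EqQuotient.on (gr l).

(* [a]_l *)
Definition gr_class (l : L) (a : piece l) : gr l := \pi_(gr l) a.

Lemma gr_classP l (a b : piece l) :
  gr_class a = gr_class b <-> same_lcoset (filt_gt l) (val a) (val b).
Proof. by split=> [/eqmodP/asboolP|ab]; last exact/eqmodP/asboolP. Qed.

Lemma gr_class_repr l (x : gr l) : gr_class (repr x) = x.
Proof. exact: reprK. Qed.

Definition gr_mul l (x y : gr l) : gr l := gr_class (repr x * repr y)%g.

Lemma gr_mulE l (a b : piece l) :
  gr_mul (gr_class a) (gr_class b) = gr_class (a * b)%g.
Proof.
rewrite /gr_mul.
have /gr_classP ra := gr_class_repr (gr_class a).
have /gr_classP rb := gr_class_repr (gr_class b).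
move: (repr _) (repr _) ra rb => a' b' ra rb; apply/gr_classP.
exact: (same_lcosetM (filt_gt_normal _) ra rb).
Qed.

Lemma filt_comm l m x y : F l x -> F m y -> F (l + m)%om (comm x y).
Proof.
move=> Fx Fy; apply: (@filt_comm_subgroup _ _ _ F); apply: sub_generated.
by exists x, y.
Qed.

Lemma piece_comm_subproof l m (a : piece l) (b : piece m) :
  comm (val a) (val b) \in F (l + m)%om.
Proof.
rewrite inE; apply: filt_comm; exact: set_mem (valP _).
Qed.

Definition piece_comm l m (a : piece l) (b : piece m) : piece (l + m)%om :=
  exist _ (comm (val a) (val b)) (piece_comm_subproof a b).

End GradedPieces.

Section GradedZmodule.
Context {d : Order.disp_t} {L : goodMonoidType d} {K : groupType}.
Variables (F : filtration L K) (l : positive L).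
Local Notation G := (gr F (sval l)).

Definition gr_one : G := gr_class 1%g.
Definition gr_inv (x : G) : G := gr_class (repr x)^-1%g.

Lemma gr_mulA : associative (@gr_mul _ _ _ F (sval l)).
Proof.
move=> x y z; rewrite -(gr_class_repr x) -(gr_class_repr y) -(gr_class_repr z).
by rewrite !gr_mulE mulgA.
Qed.

Lemma gr_mulC : commutative (@gr_mul _ _ _ F (sval l)).
Proof.
move=> x y; rewrite -(gr_class_repr x) -(gr_class_repr y) !gr_mulE.
move: (repr x) (repr y) => a b; apply/gr_classP.
apply: sub_generated; exists (sval l + sval l)%om => /=.
  by rewrite -[X in (X < _)%O](Monoid.mul1m (om_add L)); apply: good_ltD2r; exact: (valP l).
have -> : ((val (a * b)%g)^-1 * val (b * a) = comm (val b)^-1 (val a)^-1 :> K)%g.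
  exact: ldiv_commute.
have [[_ _ FV] _] := filt_normal F (sval l).
by apply: filt_comm; apply: FV; exact: set_mem (valP _).
Qed.

Lemma gr_mul1 : left_id gr_one (@gr_mul _ _ _ F (sval l)).
Proof. by move=> x; rewrite -(gr_class_repr x) gr_mulE mul1g. Qed.

Lemma gr_mulV : left_inverse gr_one gr_inv (@gr_mul _ _ _ F (sval l)).
Proof.
by move=> x; rewrite -{2}(gr_class_repr x) /gr_inv gr_mulE mulVg.
Qed.

HB.instance Definition _ := GRing.isZmodule.Build G gr_mulA gr_mulC gr_mul1
  gr_mulV.

End GradedZmodule.

Section DirectSum.
Context {I : choiceType}.
Variable M : I -> zmodType.

Definition dfinite (f : forall i, M i) : bool :=
  `[< finite_set [set i | f i != 0] >].

Definition dsum : Type := {f : forall i, M i | dfinite f}.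

HB.instance Definition _ := SubChoice.on dsum.

Definition dcoef (x : dsum) (i : I) : M i := val x i.

Definition dsupp (x : dsum) : set I := [set i | dcoef x i != 0].

Lemma dsupp_finite x : finite_set (dsupp x).
Proof. exact/asboolP/(valP x). Qed.

Lemma dsumP x y : (forall i, dcoef x i = dcoef y i) -> x = y.
Proof. by move=> xy; apply/val_inj/functional_extensionality_dep. Qed.

Lemma dzero_subproof : dfinite (fun i => 0).
Proof.
by apply/asboolP; apply: (sub_finite_set _ (finite_set0 I)) => i /=; rewrite eqxx.
Qed.

Lemma dadd_subproof x y : dfinite (fun i => dcoef x i + dcoef y i).
Proof.
apply/asboolP; apply: (@sub_finite_set _ _ (dsupp x `|` dsupp y)).
  move=> i /=; have [x0|x0] := eqVneq (dcoef x i) 0; last by left.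
  by rewrite x0 add0r; right.
by rewrite finite_setU; split; exact: dsupp_finite.
Qed.

Lemma dopp_subproof x : dfinite (fun i => - dcoef x i).
Proof.
apply/asboolP; apply: (sub_finite_set _ (dsupp_finite x)) => i /=.
by rewrite oppr_eq0.
Qed.

Definition dzero : dsum := exist dfinite _ dzero_subproof.
Definition dadd x y : dsum := exist dfinite _ (dadd_subproof x y).
Definition dopp x : dsum := exist dfinite _ (dopp_subproof x).

Lemma daddA : associative dadd.
Proof. by move=> x y z; apply: dsumP => i; apply: addrA. Qed.

Lemma daddC : commutative dadd.
Proof. by move=> x y; apply: dsumP => i; apply: addrC. Qed.

Lemma dadd0 : left_id dzero dadd.
Proof. by move=> x; apply: dsumP => i; apply: add0r. Qed.

Lemma daddN : left_inverse dzero dopp dadd.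
Proof. by move=> x; apply: dsumP => i; apply: addNr. Qed.

HB.instance Definition _ := GRing.isZmodule.Build dsum daddA daddC dadd0 daddN.

Definition dinj_fun (i : I) (x : M i) (j : I) : M j :=
  if i =P j is ReflectT e then ecast k (M k) e x else 0.

Lemma dinj_subproof i (x : M i) : dfinite (dinj_fun x).
Proof.
apply/asboolP; apply: (sub_finite_set _ (finite_set1 i)) => j /=.
by rewrite /dinj_fun; case: eqP => [e _|_]; [exact: esym|rewrite eqxx].
Qed.

Definition dinj (i : I) (x : M i) : dsum := exist dfinite _ (dinj_subproof x).

End DirectSum.

Record is_lie_algebra (R : comNzRingType) (A : lmodType R)
    (br : A -> A -> A) : Prop := {
  lie_bilinear : bilinear_for *:%R *:%R br;
  lie_alternating : forall x, br x x = 0;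
  lie_jacobi : forall x y z,
    br x (br y z) + br y (br z x) + br z (br x y) = 0
}.

Record is_direct_sum (R : comNzRingType) (A : lmodType R) (I : eqType)
    (P : I -> set A) : Prop := {
  dsum_submod0 : forall i, P i 0;
  dsum_submodD : forall i x y, P i x -> P i y -> P i (x + y);
  dsum_submodZ : forall i (c : R) x, P i x -> P i (c *: x);
  dsum_span : forall x, exists (s : seq I) (f : I -> A),
    (forall i, P i (f i)) /\ x = \sum_(i <- s) f i;
  dsum_independent : forall (s : seq I) (f : I -> A), uniq s ->
    (forall i, P i (f i)) -> \sum_(i <- s) f i = 0 ->
    forall i, i \in s -> f i = 0
}.

(* Lie algebras over Z are Lie rings: [zmodule A] is the abelian group A seen
   as a module over [int]. *)
Record is_graded_lie_algebra d (L : goodMonoidType d) (A : zmodType)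
    (br : A -> A -> A) (P : positive L -> set A) : Prop := {
  graded_lie : @is_lie_algebra int (zmodule A) br;
  graded_sum : @is_direct_sum int (zmodule A) (positive L) P;
  graded_bracket : forall l m x y,
    P l x -> P m y -> P (padd l m) (br x y)
}.

Section AssociatedGraded.
Context {d : Order.disp_t} {L : goodMonoidType d} {K : groupType}.
Variable F : filtration L K.

Definition assoc_gr : Type := dsum (fun l : positive L => gr F (sval l)).

HB.instance Definition _ := GRing.Zmodule.on assoc_gr.

Definition gr_inj (l : positive L) (x : gr F (sval l)) : assoc_gr :=
  @dinj _ (fun l : positive L => gr F (sval l)) l x.

(* Computed on chosen representatives: independence of the choice is the
   equation gr_bracket (gr_class a) (gr_class b) = gr_class (piece_comm a b). *)
Definition gr_bracket (l m : positive L) (x : gr F (sval l))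
    (y : gr F (sval m)) : gr F (sval (padd l m)) :=
  gr_class (piece_comm (repr x) (repr y)).

(* Biadditive extension of the maps gr_bracket to the direct sum. *)
Definition assoc_bracket (x y : assoc_gr) : assoc_gr :=
  \sum_(l \in dsupp x) \sum_(m \in dsupp y)
    gr_inj (gr_bracket (dcoef x l) (dcoef y m)).

End AssociatedGraded.

(* Main.v *)
(* All the Lie axioms come from commutator identities read modulo K_{>n}.  Since
   [K_l, K_m] lies in K_{l+m}, conjugation by an element of K_l with l > 0 acts
   trivially on K_m / K_{>m}; hence [ab, c] = a [b, c] a^-1 [a, c] gives
   biadditivity, [a, b]^-1 = [b, a] antisymmetry, and the Hall-Witt identity the
   Jacobi identity.  Strict monotonicity of + makes [K_{>l}, K_m] lie in
   K_{>l+m}, which gives independence of representatives.  Everything extends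
   from homogeneous elements to the direct sum by biadditivity. *)
Require Import Defs.
From HB Require Import structures.
From mathcomp Require Import all_boot all_order all_algebra.
From mathcomp Require Import boolp classical_sets functions cardinality fsbigop.

Set Implicit Arguments.
Unset Strict Implicit.
Unset Printing Implicit Defensive.

Import Order.TTheory GRing.Theory.
Local Open Scope classical_set_scope.
Local Open Scope ring_scope.

(** * Commutator identities in a group *)

Section Commutators.
Context {K : groupType}.
Implicit Types x y z : K.

Lemma commV x y : (comm x y)^-1%g = comm y x.
Proof. by rewrite /comm !invgM !invgK !mulgA. Qed.

Lemma commMl x y z : comm (x * y) z = (x * comm y z * x^-1 * comm x z)%g.
Proof. by rewrite /comm !invgM !mulgA !(mulgK, mulgVK). Qed.

Lemma commMr x y z : comm x (y * z) = (comm x y * (y * comm x z * y^-1))%g.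
Proof. by rewrite /comm !invgM !mulgA !mulgVK. Qed.

(* Hall-Witt in the variant where every conjugation sits on the outer entry of a
   double commutator: conjugating a representative by an element of positive
   degree does not change its class. *)
Lemma hall_witt x y z :
  (comm (x * y * x^-1) (comm z x) * comm (z * x * z^-1) (comm y z)
     * comm (y * z * y^-1) (comm x y) = 1)%g.
Proof.
by rewrite /comm !invgM !invgK !mulgA !(mulgK, mulgVK, mulgV, mulVg, mul1g).
Qed.

End Commutators.

(** * Additive maps of abelian groups *)

Lemma morph0 (U V : zmodType) (f : U -> V) : {morph f : x y / x + y} -> f 0 = 0.
Proof. by move=> fD; apply: (addrI (f 0)); rewrite -fD !addr0. Qed.

(** Reduces linearity over [int], for the bracket and for the homogeneous submodules, to
    additivity. *)
Lemma morphMz (U V : zmodType) (f : U -> V) :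
  {morph f : x y / x + y} -> forall n x, f (x *~ n) = f x *~ n.
Proof.
move=> fD n x.
have fN y : f (- y) = - f y.
  by apply/eqP; rewrite -addr_eq0 -fD addNr (morph0 fD).
elim/int_ind: n => [|n IH|n IH]; first by rewrite !mulr0z (morph0 fD).
  by rewrite intS !mulrzDr_tmp !mulr1z fD IH.
by rewrite intS !mulrNz in IH *; rewrite !mulrzDr_tmp !mulr1z !opprD fD fN IH.
Qed.

(** * The bracket on homogeneous pieces *)

Section GradedBracket.
Context {d : Order.disp_t} {L : goodMonoidType d} {K : groupType}.
Variable F : filtration L K.

(** Normality of K_{>l+m} makes the x satisfying the conclusion a subgroup, so generators of K_{>l}
    suffice; for these, n > l gives n + m > l + m. *)
Lemma comm_filt_gt (l m : L) x y :
  filt_gt F l x -> F m y -> filt_gt F (l + m)%om (comm x y).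
Proof.
move=> Fx Fy; move: x Fx.
have [[g1 gM gV] gJ] := filt_gt_normal F (l + m)%om.
pose B : set K := [set x | filt_gt F (l + m)%om (comm x y)].
suff: filt_gt F l `<=` B by [].
apply: smallest_sub => [|x [n ln Fx]].
  split; rewrite /B /=.
  - by rewrite /comm mul1g invg1 mulg1 mulgV.
  - move=> u v Hu Hv; rewrite commMl; apply: gM => //; exact: gJ.
  (* The commutator of [u^-1] with y is [(comm u y)^-1] conjugated by [u^-1]. *)
  - move=> u /gV /(gJ _ u^-1%g); rewrite commV invgK.
    by rewrite /comm !invgK !mulgA mulgVK.
apply: sub_generated; exists (n + m)%om; first exact: good_ltD2r.
exact: filt_comm.
Qed.

(** The two elements differ by [comm x y^-1], which lies in K_{l+m}, and l > 0 forces l + m > m. *)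
Lemma same_lcoset_conj (l m : L) x y : (0%om < l)%O -> F l x -> F m y ->
  same_lcoset (filt_gt F m) (x * y * x^-1)%g y.
Proof.
move=> l0 Fx Fy; apply: sub_generated; exists (l + m)%om => /=.
  by rewrite -[X in (X < _)%O](Monoid.mul1m (om_add L)); apply: good_ltD2r.
have [[_ _ FV] _] := filt_normal F m.
have -> : ((x * y * x^-1)^-1 * y = comm x y^-1)%g.
  by rewrite /comm !invgM !invgK !mulgA.
by apply: filt_comm => //; apply: FV.
Qed.

Lemma same_lcoset_comml (l m : L) x x' y : F m y ->
  same_lcoset (filt_gt F l) x x' ->
  same_lcoset (filt_gt F (l + m)%om) (comm x' y) (comm x y).
Proof.
move=> Fy xx'; have [[_ _ gV] gJ] := filt_gt_normal F (l + m)%om.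
(* With the discrepancy [x^-1 * x'] split off, [commMl] isolates a conjugate of its commutator with
   y, which [comm_filt_gt] controls. *)
have -> : x' = (x * (x^-1 * x'))%g by rewrite mulgA mulgV mul1g.
rewrite /same_lcoset commMl !invgM !invgK !mulgA.
have := gJ _ ((comm x y)^-1 * x)%g (gV _ (comm_filt_gt xx' Fy)).
by rewrite !invgM !invgK !mulgA.
Qed.

Lemma same_lcoset_commr (l m : L) x y y' : F l x ->
  same_lcoset (filt_gt F m) y y' ->
  same_lcoset (filt_gt F (l + m)%om) (comm x y') (comm x y).
Proof.
move=> Fx /(same_lcoset_comml Fx).
have [[_ _ gV] gJ] := filt_gt_normal F (l + m)%om.
rewrite (Monoid.mulmC (om_add L)) /same_lcoset -(commV x y') -(commV x y) invgK.
(* The left-entry case bounds [c' * c^-1], a right-coset relation; inverting and conjugating by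
   [c'^-1] yields [c'^-1 * c]. *)
move: (comm x y') (comm x y) => c' c /gV /(gJ _ c'^-1%g).
by rewrite invgM !invgK !mulgA mulgVK.
Qed.

Lemma piece_mem (n : L) (a : piece F n) : F n (val a).
Proof. exact: set_mem (valP a). Qed.

Lemma gr_bracketE (l m : positive L) (a : piece F (sval l))
    (b : piece F (sval m)) :
  gr_bracket (gr_class a) (gr_class b) = gr_class (piece_comm a b).
Proof.
have /gr_classP ra := gr_class_repr (gr_class a).
have /gr_classP rb := gr_class_repr (gr_class b).
rewrite /gr_bracket.
move: (repr (gr_class a)) (repr (gr_class b)) ra rb => a' b' ra rb.
have [gS _] := filt_gt_normal F (sval l + sval m)%om.
apply/gr_classP.
(* One entry is replaced at a time, passing through the commutator of a and b'. *)
have sb := same_lcoset_commr (piece_mem a) rb.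
exact: (same_lcoset_sym gS
  (same_lcoset_trans gS sb (same_lcoset_comml (piece_mem b') ra))).
Qed.

Lemma gr_classM (l : positive L) (a b : piece F (sval l)) :
  gr_class (a * b)%g = gr_class a + gr_class b.
Proof. by rewrite -gr_mulE. Qed.

Lemma gr_bracketDl (l m : positive L) (y : gr F (sval m)) :
  {morph (fun x : gr F (sval l) => gr_bracket x y) : x x' / x + x'}.
Proof.
move=> x x'; rewrite -(gr_class_repr x) -(gr_class_repr x') -(gr_class_repr y).
move: (repr x) (repr x') (repr y) => a a' b.
rewrite -gr_classM !gr_bracketE.
(* The sum is swapped because [commMl] puts the factor of a' first, conjugated by a. *)
rewrite addrC -gr_classM; apply/gr_classP => /=.
have gN := filt_gt_normal F (sval l + sval m)%om.
rewrite commMl; apply: (same_lcosetM gN _ (same_lcosetxx _ gN.1)).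
exact: same_lcoset_conj (valP l) (piece_mem a) (piece_mem (piece_comm a' b)).
Qed.

Lemma gr_bracketDr (l m : positive L) (x : gr F (sval l)) :
  {morph (fun y : gr F (sval m) => gr_bracket x y) : y y' / y + y'}.
Proof.
move=> y y'; rewrite -(gr_class_repr x) -(gr_class_repr y) -(gr_class_repr y').
move: (repr x) (repr y) (repr y') => a b b'.
rewrite -gr_classM !gr_bracketE.
rewrite -gr_classM; apply/gr_classP => /=.
have gN := filt_gt_normal F (sval l + sval m)%om.
rewrite commMr; apply: (same_lcosetM gN (same_lcosetxx _ gN.1)).
exact: same_lcoset_conj (valP m) (piece_mem b) (piece_mem (piece_comm a b')).
Qed.

Lemma gr_bracket0l (l m : positive L) (y : gr F (sval m)) :
  gr_bracket (0 : gr F (sval l)) y = 0.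
Proof. exact: (morph0 (@gr_bracketDl l m y)). Qed.

Lemma gr_bracket0r (l m : positive L) (x : gr F (sval l)) :
  gr_bracket x (0 : gr F (sval m)) = 0.
Proof. exact: (morph0 (@gr_bracketDr l m x)). Qed.

End GradedBracket.

(** * Homogeneous elements of a direct sum *)

Section DirectSumInjection.
Context {I : choiceType}.
Variable M : I -> zmodType.
Implicit Types x y : dsum M.

Lemma dcoefD x y i : dcoef (x + y) i = dcoef x i + dcoef y i.
Proof. by []. Qed.

Lemma dsuppD x y : dsupp (x + y) `<=` dsupp x `|` dsupp y.
Proof.
move=> i /=; rewrite /dsupp /= dcoefD.
by have [->|] := eqVneq (dcoef x i) 0; [rewrite add0r; right|left].
Qed.

Lemma dcoef_sum (J : Type) (s : seq J) (f : J -> dsum M) i :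
  dcoef (\sum_(j <- s) f j) i = \sum_(j <- s) dcoef (f j) i.
Proof. exact: (big_morph (fun x => dcoef x i) (fun _ _ => erefl) erefl). Qed.

Lemma dcoef_dinj i (u : M i) : dcoef (dinj u) i = u.
Proof.
rewrite /dcoef /= /dinj_fun; case: eqP => // e.
(* Proofs of [i = i] in a type with decidable equality are unique, so the cast is the identity. *)
by rewrite (eq_axiomK e).
Qed.

Lemma dcoef_dinj_neq i j (u : M i) : i != j -> dcoef (dinj u) j = 0.
Proof. by rewrite /dcoef /= /dinj_fun; case: eqP. Qed.

Lemma dinjD i : {morph @dinj _ M i : u v / u + v}.
Proof.
move=> u v; apply: dsumP => j; rewrite dcoefD.
have [<-|ij] := eqVneq i j; first by rewrite !dcoef_dinj.
by rewrite !dcoef_dinj_neq ?addr0.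
Qed.

Lemma dinj0 i : dinj (0 : M i) = 0.
Proof. exact: (morph0 (@dinjD i)). Qed.

Lemma dsum_decomposition x :
  x = \sum_(i <- finmap.enum_fset (fset_set (dsupp x))) dinj (dcoef x i).
Proof.
apply: dsumP => i; rewrite dcoef_sum.
set s := finmap.enum_fset _.
have memP j : (j \in s) = (dcoef x j != 0).
  rewrite /s in_fset_set; last exact: dsupp_finite.
  by apply/idP/idP; rewrite inE.
have [xi|xi] := eqVneq (dcoef x i) 0.
  rewrite xi big_seq big1 // => j; rewrite memP => xj.
  by rewrite dcoef_dinj_neq //; apply: contraNneq xj => ->; rewrite xi.
rewrite (bigD1_seq i) ?memP ?finmap.fset_uniq //= dcoef_dinj.
by rewrite big1 ?addr0 // => j ji; rewrite dcoef_dinj_neq.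
Qed.

Lemma dsum_ind (P : dsum M -> Prop) : P 0 ->
  (forall x y, P x -> P y -> P (x + y)) ->
  (forall i (u : M i), P (dinj u)) -> forall x, P x.
Proof.
by move=> P0 PD Pi x; rewrite (dsum_decomposition x); apply: big_ind.
Qed.

Lemma is_direct_sum_dinj :
  @is_direct_sum int (zmodule (dsum M)) I (fun i => range (@dinj _ M i)).
Proof.
split.
- by move=> i; exists 0 => //; rewrite dinj0.
- by move=> i _ _ [u _ <-] [v _ <-]; exists (u + v) => //; rewrite dinjD.
- by move=> i c _ [u _ <-]; exists (u *~ c) => //; rewrite (morphMz (@dinjD i)).
- move=> x; exists (finmap.enum_fset (fset_set (dsupp x))).
  exists (fun i => dinj (dcoef x i)); split; last exact: dsum_decomposition.
  by move=> i; exists (dcoef x i).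
- move=> s f us Pf fs0 i si; have [u _ fi] := Pf i.
  suff u0 : u = 0 by rewrite -fi u0 dinj0.
  rewrite -(dcoef_dinj u) fi.
  (* Coordinate i of the vanishing sum sees only the term [f i]. *)
  have := congr1 (fun x : dsum M => dcoef x i) fs0.
  rewrite dcoef_sum (bigD1_seq i) //= big1 ?addr0 // => j ji.
  by have [v _ <-] := Pf j; rewrite dcoef_dinj_neq.
Qed.

End DirectSumInjection.

(** * The biadditive bracket on the direct sum *)

Section AssociatedBracket.
Context {d : Order.disp_t} {L : goodMonoidType d} {K : groupType}.
Variable F : filtration L K.
Local Notation A := (assoc_gr F).
Local Notation br := (@assoc_bracket d L K F).
Implicit Types x y z : A.

Lemma gr_injD (l : positive L) : {morph @gr_inj d L K F l : u v / u + v}.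
Proof. exact: dinjD. Qed.

Lemma gr_inj0 (l : positive L) : gr_inj (0 : gr F (sval l)) = 0.
Proof. exact: dinj0. Qed.

(** Enlarging the index sets adds only zero terms. This allows brackets of x, x' and x + x', whose
    supports differ, to be compared over one common set. *)
Lemma assoc_bracketE (B C : set (positive L)) x y :
  dsupp x `<=` B -> dsupp y `<=` C ->
  br x y = \sum_(l \in B) \sum_(m \in C)
    gr_inj (gr_bracket (dcoef x l) (dcoef y m)).
Proof.
move=> xB yC; rewrite /assoc_bracket.
rewrite (fsbig_widen _ _ _ xB) => [|l [_ /= /negP]]; last first.
  rewrite negbK => /eqP ->; apply: fsbig1 => m _.
  by rewrite gr_bracket0l gr_inj0.
apply: eq_fsbigr => l _; apply: (fsbig_widen _ _ _ yC) => m [_ /= /negP].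
by rewrite negbK => /eqP ->; rewrite gr_bracket0r gr_inj0.
Qed.

Lemma assoc_bracket_inj (l m : positive L) (u : gr F (sval l))
    (v : gr F (sval m)) : br (gr_inj u) (gr_inj v) = gr_inj (gr_bracket u v).
Proof.
(* Only an inclusion holds: the support is empty when w = 0. *)
have supp1 (n : positive L) (w : gr F (sval n)) :
    dsupp (gr_inj w) `<=` [set n].
  move=> k; apply: contraNeq; rewrite eq_sym => nk.
  by rewrite /gr_inj (@dcoef_dinj_neq _ (fun l : positive L => gr F (sval l))).
rewrite (assoc_bracketE (@supp1 _ u) (@supp1 _ v)) !fsbig_set1.
by rewrite /gr_inj !(@dcoef_dinj _ (fun l : positive L => gr F (sval l))).
Qed.

Lemma assoc_bracketDl y : {morph br^~ y : x x' / x + x'}.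
Proof.
move=> x x'; set B := dsupp x `|` dsupp x'.
have fB : finite_set B by rewrite finite_setU; split; exact: dsupp_finite.
have yy : dsupp y `<=` dsupp y by [].
rewrite (assoc_bracketE (@dsuppD _ _ x x') yy).
rewrite (assoc_bracketE (@subsetUl _ _ _ : dsupp x `<=` B) yy).
rewrite (assoc_bracketE (@subsetUr _ _ _ : dsupp x' `<=` B) yy).
rewrite -fsbig_split //=; apply: eq_fsbigr => l _.
rewrite -fsbig_split //=; last exact: dsupp_finite.
by apply: eq_fsbigr => m _; rewrite dcoefD gr_bracketDl gr_injD.
Qed.

Lemma assoc_bracketDr x : {morph br x : y y' / y + y'}.
Proof.
move=> y y'; set B := dsupp y `|` dsupp y'.
have fB : finite_set B by rewrite finite_setU; split; exact: dsupp_finite.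
have xx : dsupp x `<=` dsupp x by [].
rewrite (assoc_bracketE xx (@dsuppD _ _ y y')).
rewrite (assoc_bracketE xx (@subsetUl _ _ _ : dsupp y `<=` B)).
rewrite (assoc_bracketE xx (@subsetUr _ _ _ : dsupp y' `<=` B)).
rewrite -fsbig_split //=; last exact: dsupp_finite.
apply: eq_fsbigr => l _; rewrite -fsbig_split //=.
by apply: eq_fsbigr => m _; rewrite dcoefD gr_bracketDr gr_injD.
Qed.

Lemma assoc_bracket0l y : br 0 y = 0.
Proof. exact: (morph0 (assoc_bracketDl y)). Qed.

Lemma assoc_bracket0r x : br x 0 = 0.
Proof. exact: (morph0 (assoc_bracketDr x)). Qed.

(** Reduces additive identities to classes of group elements, where they become commutator
    identities. *)
Lemma assoc_gr_ind (P : A -> Prop) : P 0 ->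
  (forall x y, P x -> P y -> P (x + y)) ->
  (forall (l : positive L) (a : piece F (sval l)), P (gr_inj (gr_class a))) ->
  forall x, P x.
Proof.
move=> P0 PD Pi; apply: dsum_ind => // l u.
by rewrite -[u]gr_class_repr; apply: Pi.
Qed.

(* Degrees such as l + m and m + l are equal but not convertible, so their
   graded pieces are different types. *)
Lemma gr_inj_cast (l m : positive L) (a : piece F (sval l)) : l = m ->
  exists2 b : piece F (sval m),
    val b = val a & gr_inj (gr_class a) = gr_inj (gr_class b).
Proof. by move=> lm; case: m / lm; exists a. Qed.

Lemma paddC (l m : positive L) : padd l m = padd m l.
Proof. by apply: val_inj; apply: Monoid.mulmC. Qed.

Lemma paddA (l m n : positive L) : padd l (padd m n) = padd (padd l m) n.
Proof. by apply: val_inj; apply: Monoid.mulmA. Qed.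

(** * Alternation and the Jacobi identity *)

Lemma assoc_bracket_antisym x y : br x y + br y x = 0.
Proof.
elim/assoc_gr_ind: x => [|x x' IH IH'|l a].
- by rewrite assoc_bracket0l assoc_bracket0r addr0.
- by rewrite assoc_bracketDl assoc_bracketDr addrACA IH IH' addr0.
elim/assoc_gr_ind: y => [|y y' IH IH'|m b].
- by rewrite assoc_bracket0l assoc_bracket0r addr0.
- by rewrite assoc_bracketDl assoc_bracketDr addrACA IH IH' addr0.
rewrite !assoc_bracket_inj !gr_bracketE.
have [c cE ->] :=
  @gr_inj_cast (padd m l) (padd l m) (piece_comm b a) (paddC m l).
rewrite -gr_injD -gr_classM -[RHS](gr_inj0 (padd l m)).
congr (gr_inj (gr_class _)); apply: val_inj.
by rewrite /= cE /= -(commV (val a)) mulgV.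
Qed.

(** Antisymmetry alone only kills twice [br x x]. It cancels the cross terms of a sum, while the
    homogeneous case rests on [comm a a] being 1. *)
Lemma assoc_bracket_alternating x : br x x = 0.
Proof.
elim/assoc_gr_ind: x => [|x x' IH IH'|l a].
- exact: assoc_bracket0l.
- rewrite assoc_bracketDl !assoc_bracketDr IH IH' add0r addr0.
  exact: assoc_bracket_antisym.
rewrite assoc_bracket_inj gr_bracketE -[RHS](gr_inj0 (padd l l)).
congr gr_inj; apply/gr_classP => /=.
rewrite /comm mulgK mulgV; exact: same_lcosetxx (filt_gt_normal _ _).1.
Qed.

Lemma gr_class_conj (l m : positive L) (c : piece F (sval m))
    (a : piece F (sval l)) :
  exists2 a' : piece F (sval l),
    val a' = (val c * val a * (val c)^-1)%g & gr_class a' = gr_class a.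
Proof.
have Fca : (val c * val a * (val c)^-1)%g \in F (sval l).
  by rewrite inE; apply: (filt_normal F _).2; exact: piece_mem.
exists (exist (fun u : K => u \in F (sval l)) _ Fca) => //; apply/gr_classP.
exact: same_lcoset_conj (valP m) (piece_mem c) (piece_mem a).
Qed.

Lemma assoc_bracket_jacobi x y z :
  br x (br y z) + br y (br z x) + br z (br x y) = 0.
Proof.
have addrACA3 (t1 t2 t3 t1' t2' t3' : A) : (t1 + t1') + (t2 + t2') + (t3 + t3')
    = (t1 + t2 + t3) + (t1' + t2' + t3').
  by rewrite [t1 + t1' + _]addrACA [RHS]addrACA.
elim/assoc_gr_ind: x => [|x x' IH IH'|l a].
- by rewrite !(assoc_bracket0l, assoc_bracket0r) !addr0.
- by rewrite !(assoc_bracketDl, assoc_bracketDr) addrACA3 IH IH' addr0.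
elim/assoc_gr_ind: y => [|y y' IH IH'|m b].
- by rewrite !(assoc_bracket0l, assoc_bracket0r) !addr0.
- by rewrite !(assoc_bracketDl, assoc_bracketDr) addrACA3 IH IH' addr0.
elim/assoc_gr_ind: z => [|z z' IH IH'|n c].
- by rewrite !(assoc_bracket0l, assoc_bracket0r) !addr0.
- by rewrite !(assoc_bracketDl, assoc_bracketDr) addrACA3 IH IH' addr0.
rewrite !assoc_bracket_inj (gr_bracketE b c).
rewrite (gr_bracketE c a) (gr_bracketE a b).
(* Each outer entry becomes the conjugate that stands in its place in [hall_witt]. *)
have [a' a'E <-] := gr_class_conj c a.
have [b' b'E <-] := gr_class_conj a b.
have [c' c'E <-] := gr_class_conj b c.
rewrite (gr_bracketE (m := padd m n)) (gr_bracketE (m := padd n l)).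
rewrite (gr_bracketE (m := padd l m)).
(* All three terms are moved to degree l + (m + n), so that they add up inside one graded piece. *)
have [v vE ->] := @gr_inj_cast (padd m (padd n l)) (padd l (padd m n))
  (piece_comm b' (piece_comm c a)) (etrans (paddA m n l) (paddC _ l)).
have [w wE ->] := @gr_inj_cast (padd n (padd l m)) (padd l (padd m n))
  (piece_comm c' (piece_comm a b)) (etrans (paddC n _) (esym (paddA l m n))).
(* The swap matches [hall_witt], whose first factor is the one with outer entry b'. *)
rewrite [X in X + _]addrC -!gr_injD -(gr_classM v) -gr_classM.
rewrite -[RHS](gr_inj0 (padd l (padd m n))).
congr (gr_inj (gr_class _)); apply: val_inj.
by rewrite /= vE wE /= a'E b'E c'E hall_witt.
Qed.

End AssociatedBracket.

Theorem proposition2p5 (d : Order.disp_t) (L : goodMonoidType d)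
    (K : groupType) (F : filtration L K) :
  [/\ forall (l m : positive L) (a : piece F (sval l)) (b : piece F (sval m)),
        gr_bracket (gr_class a) (gr_class b) = gr_class (piece_comm a b),
      forall (l m : positive L) (x : gr F (sval l)) (y : gr F (sval m)),
        assoc_bracket (gr_inj x) (gr_inj y) = gr_inj (gr_bracket x y)
    & is_graded_lie_algebra (@assoc_bracket d L K F)
        (fun l : positive L => range (@gr_inj d L K F l))].
Proof.
split; [exact: gr_bracketE|exact: assoc_bracket_inj|].
split.
- split.
  + split=> u c x y.
      by rewrite assoc_bracketDl (morphMz (assoc_bracketDl u)).
    by rewrite assoc_bracketDr (morphMz (assoc_bracketDr u)).
  + exact: assoc_bracket_alternating.
  + exact: assoc_bracket_jacobi.
- exact: is_direct_sum_dinj.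
- move=> l m _ _ [u _ <-] [v _ <-]; rewrite assoc_bracket_inj.
  by exists (gr_bracket u v).
Qed.
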